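(* Let $\rho_1,\rho_2\in\mathcal{D}(\mathcal{H}_A)$ and $\sigma_{AB}\in\mathcal{D}(\mathcal{H}_A\otimes\mathcal{H}_B)$ be unknown states and $\phi\in[0,2\pi)$. Let $$H=\tfrac12\cos(\phi)\{\rho_1,\rho_2\}+\tfrac12\sin(\phi)\,i[\rho_1,\rho_2].$$ For $t\in\mathbb{R}$, $\delta>0$, there is a protocol (fixed independently of the unknown states) using $n=O(t^2/\delta)$ copies each of $\rho_1$ and $\rho_2$ that transforms $\sigma_{AB}$ into $\tilde\sigma_{AB}$ with $$\tfrac12\big\|(e^{-iHt}\otimes\mathbb{1}_B)\sigma_{AB}(e^{iHt}\otimes\mathbb{1}_B)-\tilde\sigma_{AB}\big\|_1\le O(\delta).$$ In particular ($\phi=0$ and $\phi=\pi/2$) this simulates $\tfrac12\{\rho_1,\rho_2\}$ and $\tfrac12 i[\rho_1,\rho_2]$.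
   Context: $\{A,B\}=AB+BA$ and $i[A,B]=i(AB-BA)$. $\mathcal{D}(\mathcal{H})$ denotes density operators on $\mathcal{H}$; $\|A\|_1=\operatorname{Tr}\sqrt{AA^\dagger}$. *)

(* Defs.v *)
(* matrices over the complex numbers R[i] (R : realType). *)
From HB Require Import structures.
From mathcomp Require Import all_boot all_order all_algebra.
From mathcomp Require Import complex mxtens.
From mathcomp Require Import boolp classical_sets reals trigo.
Set Implicit Arguments. Unset Strict Implicit. Unset Printing Implicit Defensive.
Import Order.TTheory GRing.Theory Num.Theory Num.Def.
Local Open Scope ring_scope.
Local Open Scope complex_scope.

Local Open Scope sesquilinear_scope.
Notation "A *t B" := (tensmx A B) (at level 40, left associativity, format "A  *t  B").

Section Quantum.
Variable R : realType.
Local Notation C := R[i].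

(* Hermitian and positive semidefinite matrices *)
Definition hermmx n (A : 'M[C]_n) : Prop := A ^t* = A.
Definition psdmx n (A : 'M[C]_n) : Prop :=
  hermmx A /\ forall v : 'rV[C]_n, 0 <= (v *m A *m v ^t*) 0 0.

(* density operators D(H) on C^n *)
Definition density n (A : 'M[C]_n) : Prop := psdmx A /\ \tr A = 1.

(* e^{-i H t} for Hermitian H, defined via a spectral decomposition
   H = V^* diag(d) V (V unitary, d real):  e^{-iHt} = V^* diag(e^{-i d_k t}) V *)
Definition expmiHt n (H : 'M[C]_n) (t : R) : 'M[C]_n :=
  xget 0 [set U | exists (V : 'M[C]_n) (d : 'rV[R]_n),
     [/\ V \is unitarymx,
         H = V ^t* *m diag_mx (\row_k ((d 0 k)%:C)) *m V &
         U = V ^t* *m diag_mx (\row_k ((cos (- (d 0 k * t)))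
                                        +i* (sin (- (d 0 k * t))))) *m V]].

(* the positive semidefinite square root *)
Definition psd_sqrt n (M : 'M[C]_n) : 'M[C]_n :=
  xget 0 [set P | psdmx P /\ P *m P = M].

(* trace norm ||A||_1 = Tr sqrt(A A^dagger) *)
Definition trnorm n (A : 'M[C]_n) : R := complex.Re (\tr (psd_sqrt (A *m A ^t*))).

(* quantum channel (CPTP map) from C^{m x m} to C^{k x k}, in Kraus form *)
Definition channel m k (Phi : 'M[C]_m -> 'M[C]_k) : Prop :=
  exists (r : nat) (K : 'I_r -> 'M[C]_(k, m)),
    \sum_(j < r) (K j) ^t* *m K j = 1%:M /\
    forall X, Phi X = \sum_(j < r) K j *m X *m (K j) ^t*.

(* n-fold tensor power *)
Fixpoint tpow d (A : 'M[C]_d) (n : nat) : 'M[C]_(d ^ n) :=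
  match n with
  | 0 => castmx (esym (expn0 d), esym (expn0 d)) (1%:M : 'M[C]_1)
  | n'.+1 => castmx (esym (expnS d n'), esym (expnS d n')) (A *t tpow A n')
  end.

(* H = 1/2 cos(phi) {rho1,rho2} + 1/2 sin(phi) i[rho1,rho2] *)
Definition Hphi d (phi : R) (rho1 rho2 : 'M[C]_d) : 'M[C]_d :=
  ((cos phi / 2)%:C) *: (rho1 *m rho2 + rho2 *m rho1)
  + ((sin phi / 2)%:C * 'i) *: (rho1 *m rho2 - rho2 *m rho1).

End Quantum.

(* Main.v *)
(* Let S be the cyclic shift of the registers A1 A2 A and w = exp(i phi). The average
   of the two conjugations by c - i s w^* S and c - i s w S^-1, with c = cos tau
   and s = sin tau, followed by the partial trace over A1 A2, is a channel that maps
   rho1 (x) rho2 (x) sigma to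
     c^2 sigma + s^2 (D1 + D2) / 2 - i c s [H, sigma]
   for some states D1 and D2. Since |H| <= 1, this differs from
   exp(-i H tau) sigma exp(i H tau) by O(tau^2) in trace norm, uniformly in the
   dimension. Iterating n = floor(t^2 / delta) + 1 times with tau = t / n, the errors
   add up to n O(t^2 / n^2) = O(delta).
   Trace-norm bounds are obtained from decompositions A = P - Q with P and Q
   positive, for which the triangle inequality is immediate. *)

Require Import Defs.
From mathcomp Require Import all_boot all_order all_algebra.
From mathcomp Require Import complex mxtens zify ring lra.
From mathcomp Require Import boolp classical_sets reals.
From mathcomp Require Import topology normedtype derive trigo.
Import Order.TTheory GRing.Theory Num.Theory Num.Def.
Local Open Scope ring_scope.
Local Open Scope complex_scope.
Local Open Scope sesquilinear_scope.

Set Implicit Arguments. Unset Strict Implicit. Unset Printing Implicit Defensive.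

(** * Adjoints and matrices diagonal in a fixed unitary basis *)

Section Adjoint.
Context {C : numClosedFieldType}.

Lemma adjmxM m n p (A : 'M[C]_(m, n)) (B : 'M[C]_(n, p)) :
  (A *m B) ^t* = B ^t* *m A ^t*.
Proof. by rewrite trmx_mul map_mxM. Qed.

Lemma adjmxD m n (A B : 'M[C]_(m, n)) : (A + B) ^t* = A ^t* + B ^t*.
Proof. by rewrite linearD map_mxD. Qed.

Lemma adjmxN m n (A : 'M[C]_(m, n)) : (- A) ^t* = - A ^t*.
Proof. by rewrite linearN map_mxN. Qed.

Lemma adjmxB m n (A B : 'M[C]_(m, n)) : (A - B) ^t* = A ^t* - B ^t*.
Proof. by rewrite adjmxD adjmxN. Qed.

Lemma adjmxZ m n a (A : 'M[C]_(m, n)) : (a *: A) ^t* = conjC a *: A ^t*.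
Proof. by rewrite linearZ map_mxZ. Qed.

Lemma adjmx_sum m n (I : Type) (r : seq I) (P : pred I) (F : I -> 'M[C]_(m, n)) :
  (\sum_(i <- r | P i) F i) ^t* = \sum_(i <- r | P i) (F i) ^t*.
Proof. by rewrite linear_sum raddf_sum. Qed.

Lemma adjmx1 n : (1%:M : 'M[C]_n) ^t* = 1%:M.
Proof. by rewrite trmx1 map_mx1. Qed.

Lemma adjmx_tens m n p q (A : 'M[C]_(m, n)) (B : 'M[C]_(p, q)) :
  (A *t B) ^t* = A ^t* *t B ^t*.
Proof. by rewrite trmx_tens map_mxT. Qed.

Lemma adjmx_diag n (g : 'rV[C]_n) :
  (diag_mx g) ^t* = diag_mx (map_mx conjC g).
Proof. by rewrite tr_diag_mx map_diag_mx. Qed.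

Lemma tensmx11 m n : (1%:M : 'M[C]_m) *t (1%:M : 'M[C]_n) = 1%:M.
Proof.
apply/matrixP => i j; case: (mxtens_indexP i) => a b.
case: (mxtens_indexP j) => a' b'; rewrite tensmxE !mxE -natrM mulnb.
by rewrite (can_eq (@mxtens_indexK _ _)).
Qed.

(** Functional calculus in the eigenbasis [V]. Taking the eigenvalues as a function makes sums,
    products and adjoints of such matrices pointwise. *)
Definition udiag n (V : 'M[C]_n) (g : 'I_n -> C) : 'M[C]_n :=
  V ^t* *m diag_mx (\row_k g k) *m V.

Lemma udiag_ext n (V : 'M[C]_n) f g : f =1 g -> udiag V f = udiag V g.
Proof.
move=> fg; rewrite /udiag; congr (_ *m diag_mx _ *m _).
by apply/rowP=> k; rewrite !mxE.
Qed.

Lemma udiagD n (V : 'M[C]_n) f g :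
  udiag V f + udiag V g = udiag V (fun k => f k + g k).
Proof.
rewrite /udiag -mulmxDl -mulmxDr -linearD /=; congr (_ *m diag_mx _ *m _).
by apply/rowP=> k; rewrite !mxE.
Qed.

Lemma udiagZ n (V : 'M[C]_n) a f : a *: udiag V f = udiag V (fun k => a * f k).
Proof.
rewrite /udiag scalemxAl scalemxAr -linearZ /=; congr (_ *m diag_mx _ *m _).
by apply/rowP=> k; rewrite !mxE.
Qed.

Lemma udiag_adj n (V : 'M[C]_n) f : (udiag V f) ^t* = udiag V (fun k => conjC (f k)).
Proof.
rewrite /udiag !adjmxM trmxCK mulmxA adjmx_diag; congr (_ *m diag_mx _ *m _).
by apply/rowP=> k; rewrite !mxE.
Qed.

Lemma unitarymx_adjK n (V : 'M[C]_n) : V \is unitarymx -> V ^t* *m V = 1%:M.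
Proof. by move/unitarymxP=> VV; apply: mulmx1C. Qed.

Lemma udiagM n (V : 'M[C]_n) f g : V \is unitarymx ->
  udiag V f *m udiag V g = udiag V (fun k => f k * g k).
Proof.
move=> /unitarymxP VV; rewrite /udiag !mulmxA -[_ *m V *m _]mulmxA VV mulmx1.
rewrite -[_ *m diag_mx _ *m diag_mx _]mulmxA mulmx_diag.
congr (_ *m diag_mx _ *m _).
by apply/rowP=> k; rewrite !mxE.
Qed.

Lemma udiag1 n (V : 'M[C]_n) : V \is unitarymx -> udiag V (fun=> 1) = 1%:M.
Proof.
move=> VU; rewrite /udiag (_ : \row__ 1 = const_mx 1) ?diag_const_mx ?mulmx1.
  exact: unitarymx_adjK.
by apply/rowP=> k; rewrite !mxE.
Qed.

Lemma udiagK n (V : 'M[C]_n) f : V \is unitarymx ->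
  V *m udiag V f *m V ^t* = diag_mx (\row_k f k).
Proof.
move=> /unitarymxP VV; rewrite /udiag !mulmxA VV mul1mx.
by rewrite -mulmxA VV mulmx1.
Qed.

Lemma diag_entry n (f : 'I_n -> C) k : (diag_mx (\row_k f k)) k k = f k.
Proof. by rewrite !mxE eqxx mulr1n. Qed.

Lemma mxtrace_udiag_mul n (V S : 'M[C]_n) f :
  \tr (udiag V f *m S) = \sum_k f k * (V *m S *m V ^t*) k k.
Proof.
rewrite /udiag -!mulmxA mxtrace_mulC -!mulmxA.
by apply: eq_bigr => k _; rewrite mul_diag_mx [LHS]mxE [X in X * _]mxE.
Qed.

End Adjoint.

(** * Positive matrices, square roots and trace-norm certificates *)

Section Positive.
Context {C : numClosedFieldType}.

(* For [C = R[i]] the predicates [is_psd], [is_density] and [is_channel] are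
   convertible to [psdmx], [density] and [channel]. *)
Definition is_psd n (A : 'M[C]_n) : Prop :=
  A ^t* = A /\ forall v : 'rV[C]_n, 0 <= (v *m A *m v ^t*) 0 0.

Lemma psdmx_conj m n (K : 'M[C]_(m, n)) (A : 'M[C]_n) :
  is_psd A -> is_psd (K *m A *m K ^t*).
Proof.
move=> [hA pA]; split; first by rewrite !adjmxM trmxCK hA mulmxA.
by move=> v; have := pA (v *m K); rewrite adjmxM !mulmxA.
Qed.

Lemma psdmx0 n : is_psd (0 : 'M[C]_n).
Proof.
split; first by rewrite trmx0 map_mx0.
by move=> v; rewrite mulmx0 mul0mx mxE.
Qed.

Lemma psdmx1 n : is_psd (1%:M : 'M[C]_n).
Proof.
split; first exact: adjmx1.
by move=> v; rewrite mulmx1 mxE sumr_ge0 // => k _; rewrite !mxE mul_conjC_ge0.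
Qed.

Lemma psdmxD n (A B : 'M[C]_n) : is_psd A -> is_psd B -> is_psd (A + B).
Proof.
move=> [hA pA] [hB pB]; split; first by rewrite adjmxD hA hB.
by move=> v; rewrite mulmxDr mulmxDl mxE addr_ge0.
Qed.

Lemma psdmxZ n (a : C) (A : 'M[C]_n) : 0 <= a -> is_psd A -> is_psd (a *: A).
Proof.
move=> a0 [hA pA]; split; last first.
  by move=> v; rewrite -scalemxAr -scalemxAl mxE mulr_ge0.
by rewrite adjmxZ hA (geC0_conj a0).
Qed.

Lemma psdmx_sum n (I : Type) (r : seq I) (P : pred I) (F : I -> 'M[C]_n) :
  (forall i, is_psd (F i)) -> is_psd (\sum_(i <- r | P i) F i).
Proof.
by move=> pF; elim/big_ind: _ => [|A B|i _]; [exact: psdmx0|exact: psdmxD|].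
Qed.

Lemma psdmx_diag_ge0 n (A : 'M[C]_n) k : is_psd A -> 0 <= A k k.
Proof.
move=> [_ /(_ (delta_mx 0 k))]; rewrite -rowE.
rewrite mxE (bigD1 k) //= big1 ?addr0 => [|j jk]; rewrite !mxE.
  by rewrite !eqxx /= conjC1 mulr1.
by rewrite (negPf jk) andbF /= conjC0 mulr0.
Qed.

Lemma herm_spectral n (A : 'M[C]_n) : A ^t* = A ->
  exists (V : 'M[C]_n) (d : 'I_n -> C),
    [/\ V \is unitarymx, forall k, d k \is Num.real & A = udiag V d].
Proof.
move=> hA; have sA : A \is hermsymmx.
  by apply/eqP; rewrite expr0 scale1r hA.
exists (spectralmx A), (fun k => spectral_diag A 0 k).
split; first exact: spectral_unitarymx.
  by move=> k; have /mxOverP := hermitian_spectral_diag_real sA; apply.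
have /orthomx_spectralP {1}-> := hermitian_normalmx sA.
rewrite invmx_unitary ?spectral_unitarymx // /udiag.
by congr (_ *m diag_mx _ *m _); apply/rowP => k; rewrite !mxE.
Qed.

Lemma udiag_psd n (V : 'M[C]_n) f : V \is unitarymx ->
  (forall k, 0 <= f k) -> is_psd (udiag V f).
Proof.
move=> VU f0; suff /(psdmx_conj (V ^t*)): is_psd (diag_mx (\row_k f k)).
  by rewrite trmxCK.
split; first by rewrite adjmx_diag; congr diag_mx;
  apply/rowP => k; rewrite !mxE (geC0_conj (f0 k)).
move=> v; rewrite mul_mx_diag mxE sumr_ge0 // => k _; rewrite !mxE.
by rewrite mulrAC mulr_ge0 // mul_conjC_ge0.
Qed.

Lemma row_conj_entry n (V A : 'M[C]_n) k :
  (row k V *m A *m (row k V) ^t*) 0 0 = (V *m A *m V ^t*) k k.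
Proof.
rewrite -row_mul mxE [RHS]mxE; apply: eq_bigr => j _.
by congr (_ * _); rewrite !mxE.
Qed.

Lemma udiag_entry n (V : 'M[C]_n) f k : V \is unitarymx ->
  (row k V *m udiag V f *m (row k V) ^t*) 0 0 = f k.
Proof. by move=> VU; rewrite row_conj_entry udiagK // diag_entry. Qed.

Lemma row_udiag n (V : 'M[C]_n) f k : V \is unitarymx ->
  row k V *m udiag V f = f k *: row k V.
Proof.
move=> /unitarymxP VV; rewrite -row_mul /udiag !mulmxA VV mul1mx.
by rewrite mul_diag_mx; apply/rowP => j; rewrite !mxE.
Qed.

(* In an eigenbasis of T, commutation with T ^ 2 forces commutation with T, so
   (S - T) (S + T) = 0; testing on an eigenvector of S - T kills its eigenvalue. *)
Lemma psdmx_sqr_inj n (S T : 'M[C]_n) :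
  is_psd S -> is_psd T -> S *m S = T *m T -> S = T.
Proof.
move=> pS pT ST; have [V [t [VU tR TE]]] := herm_spectral pT.1.
pose W := V *m S *m V ^t*; pose D := V *m T *m V ^t*.
have DE : D = diag_mx (\row_k t k) by rewrite /D TE udiagK.
have pW : is_psd W by apply: psdmx_conj.
have pD : is_psd D by apply: psdmx_conj.
have sq A B : (V *m A *m V ^t*) *m (V *m B *m V ^t*) = V *m (A *m B) *m V ^t*.
  by rewrite !mulmxA mulmxKtV.
have WD : W *m W = D *m D by rewrite !sq ST.
have t0 k : 0 <= t k.
  by have := psdmx_diag_ge0 k pD; rewrite DE diag_entry.
have comWD : W *m D = D *m W.
  have cW2 : W *m (D *m D) = (D *m D) *m W by rewrite -WD mulmxA.
  apply/matrixP => i j; move/matrixP/(_ i j): cW2.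
  rewrite DE mulmx_diag mul_mx_diag mul_diag_mx mul_mx_diag mul_diag_mx.
  rewrite [LHS]mxE [in RHS]mxE => /eqP; rewrite [_ * W i j]mulrC -subr_eq0 -mulrBr.
  rewrite mulf_eq0 => /orP[/eqP W0|]; first by rewrite [LHS]mxE [RHS]mxE W0 mul0r mulr0.
  rewrite !mxE subr_eq0 -!expr2 eqrXn2 // => /eqP ->.
  by rewrite mulrC.
have XP : (W - D) *m (W + D) = 0.
  by rewrite mulmxBl !mulmxDr WD comWD [X in X - _]addrC subrr.
have hX : (W - D) ^t* = W - D by rewrite adjmxB pW.1 pD.1.
have [Z [x [ZU xR XE]]] := herm_spectral hX.
have x0 k : x k = 0.
  pose v := row k Z.
  have xE : x k = (v *m W *m v ^t*) 0 0 - (v *m D *m v ^t*) 0 0.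
    rewrite -(udiag_entry x k ZU) -XE mulmxBr mulmxBl.
    by rewrite [LHS]mxE [X in _ + X]mxE.
  have : (v *m (W - D) *m (W + D) *m v ^t*) 0 0 = 0.
    by rewrite -(mulmxA v) XP mulmx0 mul0mx mxE.
  rewrite XE row_udiag // -scalemxAl -scalemxAl mulmxDr mulmxDl.
  rewrite mxE [X in _ * X]mxE => /eqP; rewrite mulf_eq0.
  case/orP => [/eqP //|].
  by rewrite paddr_eq0 ?pW.2 ?pD.2 // => /andP[/eqP w0 /eqP d0]; rewrite xE w0 d0 subrr.
have : W = D.
  apply/eqP; rewrite -subr_eq0 XE (_ : udiag _ _ = 0) //.
  rewrite /udiag (_ : \row__ _ = 0) ?raddf0 ?mulmx0 ?mul0mx //.
  by apply/rowP => k; rewrite !mxE x0.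
move/(congr1 (fun A => V ^t* *m A *m V)).
by rewrite /W /D !mulmxA !(unitarymx_adjK VU) !mul1mx -!mulmxA
  !(unitarymx_adjK VU) !mulmx1.
Qed.

(** A certificate that [A] is Hermitian with trace norm at most [r]; the bound lies in [C] because
    traces do. *)
Definition trbound n (A : 'M[C]_n) (r : C) : Prop :=
  exists P Q : 'M[C]_n,
    [/\ is_psd P, is_psd Q, A = P - Q & \tr P + \tr Q <= r].

(** The witness is the absolute value of [A]. In an eigenbasis of [A], each eigenvalue is a
    difference of diagonal entries of [P] and [Q], so its modulus is at most their sum; summing
    gives the two traces. *)
Lemma trbound_sqrt n (A : 'M[C]_n) r : trbound A r ->
  exists S : 'M[C]_n, [/\ is_psd S, S *m S = A *m A ^t* & \tr S <= r].
Proof.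
case=> P [Q [pP pQ AE PQr]].
have hA : A ^t* = A by rewrite AE adjmxB pP.1 pQ.1.
have [V [d [VU dR AV]]] := herm_spectral hA.
exists (udiag V (fun k => `|d k|)); split.
- exact: udiag_psd.
- rewrite hA AV !udiagM //; apply: udiag_ext => k.
  by rewrite -!expr2 real_normK.
apply: le_trans PQr.
have trV (B : 'M[C]_n) : \tr B = \sum_k (V *m B *m V ^t*) k k.
  by rewrite -/(\tr (V *m B *m V ^t*)) mxtrace_mulC mulmxA unitarymx_adjK ?mul1mx.
rewrite 3!trV -big_split /=; apply: ler_sum => k _.
rewrite udiagK // diag_entry -(udiag_entry d k VU) -AV AE row_conj_entry.
rewrite mulmxBr mulmxBl [(_ - _ : 'M_n) _ _]mxE [(- _ : 'M_n) _ _]mxE.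
by rewrite (le_trans (ler_normB _ _)) // !ger0_norm //;
  apply/psdmx_diag_ge0/psdmx_conj.
Qed.

Lemma trboundD n (A B : 'M[C]_n) a b :
  trbound A a -> trbound B b -> trbound (A + B) (a + b).
Proof.
move=> [P [Q [pP pQ -> PQ]]] [S [T [pS pT -> ST]]].
exists (P + S), (Q + T); split; try exact: psdmxD.
  by rewrite opprD addrACA.
by rewrite !mxtraceD addrACA lerD.
Qed.

Lemma trboundN n (A : 'M[C]_n) a : trbound A a -> trbound (- A) a.
Proof.
move=> [P [Q [pP pQ -> PQ]]]; exists Q, P; split=> //; first by rewrite opprB.
by rewrite addrC.
Qed.

Lemma trbound_psd n (A : 'M[C]_n) a : is_psd A -> \tr A <= a -> trbound A a.
Proof.
move=> pA Aa; exists A, 0; split=> //; [exact: psdmx0|by rewrite subr0|].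
by rewrite mxtrace0 addr0.
Qed.

Lemma trbound_unitary n (A U : 'M[C]_n) a :
  U ^t* *m U = 1%:M -> trbound A a -> trbound (U *m A *m U ^t*) a.
Proof.
move=> UU [P [Q [pP pQ -> PQ]]].
exists (U *m P *m U ^t*), (U *m Q *m U ^t*).
split; try exact: psdmx_conj; first by rewrite mulmxBr mulmxBl.
by rewrite !(mxtrace_mulC (U *m _)) !mulmxA UU !mul1mx.
Qed.

(* Polarization: the left-hand side is the difference of the positive operators
   (X + Y) S (X + Y)^* / 2 and (X - Y) S (X - Y)^* / 2. *)
Lemma trbound_cross n (X Y S : 'M[C]_n) r : is_psd S ->
  \tr (X *m S *m X ^t*) + \tr (Y *m S *m Y ^t*) <= r ->
  trbound (X *m S *m Y ^t* + Y *m S *m X ^t*) r.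
Proof.
move=> pS XY; have h0 : 0 <= 2^-1 :> C by rewrite invr_ge0 ler0n.
exists (2^-1 *: ((X + Y) *m S *m (X + Y) ^t*)),
       (2^-1 *: ((X - Y) *m S *m (X - Y) ^t*)).
split; try by apply: psdmxZ => //; apply: psdmx_conj.
  rewrite adjmxD adjmxB !(mulmxDl, mulmxDr, mulmxN, mulNmx).
  move: (X *m S *m X ^t*) (X *m S *m Y ^t*) (Y *m S *m X ^t*) (Y *m S *m Y ^t*).
  by move=> a b c d; apply/matrixP => i j; rewrite !mxE; field.
apply: le_trans XY; rewrite adjmxD adjmxB !(mulmxDl, mulmxDr, mulmxN, mulNmx).
rewrite !(mxtraceZ, mxtraceD, raddfN) /=.
move: (\tr (X *m S *m X ^t*)) (\tr (X *m S *m Y ^t*)).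
move: (\tr (Y *m S *m X ^t*)) (\tr (Y *m S *m Y ^t*)) => c d a b.
by rewrite le_eqVlt; apply/orP; left; apply/eqP; field.
Qed.

End Positive.

(** * Quadratic bounds for sine and cosine near 0 *)

Section TrigBounds.
Import numFieldNormedType.Exports.
Local Open Scope classical_set_scope.
Local Open Scope ring_scope.
Context {R : realType}.
Implicit Types x : R.

(** The mean value theorem between 0 and [x], phrased with absolute values so that later bounds need
    no case split on the sign of [x]. *)
Let MVT0 (f df : R -> R) x : (forall y : R, is_derive y 1 f (df y)) ->
  exists2 c, `|c| <= `|x| & f x - f 0 = df c * x.
Proof.
move=> fd.
have cf (A : set R) : {within A, continuous f}.
  apply: continuous_subspaceT => y.
  by apply: differentiable_continuous; apply/derivable1_diffP; case: (fd y).
have [x0|x0] := leP 0 x.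
  have [c] := @MVT_segment R f df 0 x x0 (fun y _ => fd y) (cf _).
  rewrite in_itv /= => /andP[c0 cx] E; exists c; last by rewrite E subr0.
  by rewrite !ger0_norm.
have [c] := @MVT_segment R f df x 0 (ltW x0) (fun y _ => fd y) (cf _).
rewrite in_itv /= => /andP[c0 cx] E; exists c.
  by rewrite (ler0_norm cx) (ler0_norm (ltW x0)) lerN2.
by rewrite -opprB E sub0r mulrN opprK.
Qed.

Lemma sin_norm_le x : `|sin x| <= `|x|.
Proof.
have [c _] := MVT0 x (@is_derive_sin R); rewrite sin0 subr0 => ->.
by rewrite normrM ler_piMl // cos_max.
Qed.

Lemma cos_sub1_le x : `|cos x - 1| <= x ^+ 2.
Proof.
have [c cx] := MVT0 x (@is_derive_cos R); rewrite cos0 => ->.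
rewrite normrM normrN -[x ^+ 2]ger0_norm ?sqr_ge0 // expr2 normrM.
by rewrite ler_wpM2r // (le_trans (sin_norm_le _)).
Qed.

(** Half-angle formula: with x = 2y, the left side is 4 sin(y)^2. The sharp constant matters, since
    the left side is the square of |exp(ix) - 1|. *)
Lemma one_sub_cos_le x : 2 * (1 - cos x) <= x ^+ 2.
Proof.
have [y ->] : exists y, x = y *+ 2 by
  exists (x / 2); rewrite -[RHS]mulr_natr mulfVK ?pnatr_eq0.
have : `|sin y| ^+ 2 <= `|y| ^+ 2 by rewrite ler_pXn2r ?nnegrE // sin_norm_le.
rewrite cos_mulr2n cos2sin2 !real_normK ?num_real // => sy.
rewrite (_ : (y *+ 2) ^+ 2 = 4 * y ^+ 2); last by ring.
rewrite (_ : 2 * _ = 4 * sin y ^+ 2); last by ring.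
by rewrite ler_pM2l.
Qed.

(** The mean value theorem twice: the difference is (cos c - 1) x, and |cos c - 1| is at most |c|,
    hence at most |x|. *)
Lemma sin_sub_le x : `|sin x - x| <= x ^+ 2.
Proof.
have [c cx] := MVT0 x (@is_derive_sin R); rewrite sin0 subr0 => ->.
rewrite -[X in _ - X]mul1r -mulrBl normrM -[x ^+ 2]ger0_norm ?sqr_ge0 //.
rewrite expr2 normrM ler_wpM2r //.
have [e ec] := MVT0 c (@is_derive_cos R); rewrite cos0 => ->.
by rewrite normrM normrN (le_trans _ cx) // ler_piMl // sin_max.
Qed.

End TrigBounds.

(** * Error of a single step against the exact evolution *)

Section StepEstimate.
Context {C : numClosedFieldType}.

Definition is_density n (A : 'M[C]_n) : Prop := is_psd A /\ \tr A = 1.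

(** The trace is an average of |g k|^2: the weights are the diagonal entries of [S] in the basis
    [V], which are nonnegative and sum to 1. *)
Lemma mxtrace_udiag_conj_le n (V S : 'M[C]_n) g c :
  V \is unitarymx -> is_density S -> (forall k, `|g k| <= c) ->
  \tr (udiag V g *m S *m (udiag V g) ^t*) <= c ^+ 2.
Proof.
move=> VU [pS tS] gc.
rewrite mxtrace_mulC mulmxA udiag_adj udiagM // mxtrace_udiag_mul.
have -> : c ^+ 2 = \sum_k c ^+ 2 * (V *m S *m V ^t*) k k.
  rewrite -mulr_sumr -/(\tr (V *m S *m V ^t*)) mxtrace_mulC mulmxA.
  by rewrite unitarymx_adjK // mul1mx tS mulr1.
apply: ler_sum => k _; apply: ler_wpM2r.
  by apply: psdmx_diag_ge0; apply: psdmx_conj.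
by rewrite mulrC -normCK ler_pXn2r ?nnegrE ?(le_trans _ (gc k)).
Qed.

(* With q = a b, U = 1 + F and U - 1 + i q H = E, the difference between
   U S U^* and S - i q [H, S] is E S + S E^* + F S F^*. *)
Lemma step_estimate n (V S D1 D2 : 'M[C]_n) (d e g : 'I_n -> C) (a b t : C) :
  V \is unitarymx -> (forall k, d k \is Num.real) ->
  is_density S -> is_density D1 -> is_density D2 ->
  a \is Num.real -> b \is Num.real -> t \is Num.real ->
  a ^+ 2 + b ^+ 2 = 1 -> b ^+ 2 <= t ^+ 2 ->
  (forall k, `|e k - 1| <= `|t|) -> (forall k, `|g k| <= 4) ->
  (forall k, e k - 1 + 'i * (a * b) * d k = t ^+ 2 * g k) ->
  let U := udiag V e in let H := udiag V d in
  trbound (U *m S *m U ^t* - (a ^+ 2 *: S + (b ^+ 2 / 2) *: (D1 + D2)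
      - ('i * (a * b)) *: (H *m S - S *m H))) (20 * t ^+ 2).
Proof.
move=> VU dR dS dD1 dD2 aR bR tR ab bt e1 g4 eg U H.
pose G := udiag V g; pose F := U - 1%:M.
have FE : F = udiag V (fun k => e k - 1).
  rewrite /F -(udiag1 VU) -scaleN1r udiagZ udiagD.
  by apply: udiag_ext => k; rewrite mulN1r.
have EE : U - 1%:M + ('i * (a * b)) *: H = t ^+ 2 *: G.
  by rewrite -/F FE !udiagZ udiagD; apply: udiag_ext.
have hH : H ^t* = H.
  by rewrite udiag_adj; apply: udiag_ext => k; rewrite conj_Creal.
have t2 : 0 <= t ^+ 2 by rewrite real_exprn_even_ge0.
have b2 : 0 <= b ^+ 2 by rewrite real_exprn_even_ge0.
have tC : conjC t = t by rewrite conj_Creal.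
(* The factor t^2 of E = t^2 G is shared between [X] and [T], so that E S + S E^* becomes a cross
   term and each of its two squares is of order t^2. *)
pose T := t *: (1%:M : 'M[C]_n); pose X := t *: G.
have cross : X *m S *m T ^t* + T *m S *m X ^t* =
    (U - 1%:M + ('i * (a * b)) *: H) *m S
    + S *m (U - 1%:M + ('i * (a * b)) *: H) ^t*.
  rewrite EE /X /T !adjmxZ adjmx1 rmorphXn /= tC -!(scalemxAl, scalemxAr).
  by rewrite !scalerA mulmx1 mul1mx expr2.
have -> : U *m S *m U ^t* - (a ^+ 2 *: S + (b ^+ 2 / 2) *: (D1 + D2)
      - ('i * (a * b)) *: (H *m S - S *m H))
  = (X *m S *m T ^t* + T *m S *m X ^t*) + F *m S *m F ^t*
    + b ^+ 2 *: S + (- ((b ^+ 2 / 2) *: (D1 + D2))).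
  rewrite cross /F !(adjmxD, adjmxN, adjmxZ, adjmx1) hH.
  rewrite rmorphM /= conjCi (_ : conjC (a * b) = a * b); last first.
    by rewrite conj_Creal // realM.
  rewrite !(mulmxDl, mulmxDr, mulmxN, mulNmx, mulmx1, mul1mx).
  rewrite -!(scalemxAl, scalemxAr).
  have -> : b ^+ 2 = 1 - a ^+ 2 by rewrite -ab addrAC subrr add0r.
  move: (U *m S *m U ^t*) (U *m S) (S *m U ^t*) (H *m S) (S *m H).
  move=> m1 m2 m3 m4 m5.
  by apply/matrixP => i j; rewrite !mxE; field.
(* The cross term costs 16 + 1, since |g k| is at most 4; F S F^*, b^2 S and the average of [D1] and
   [D2] cost t^2 each. *)
have -> : 20 * t ^+ 2 = 17 * t ^+ 2 + t ^+ 2 + t ^+ 2 + t ^+ 2 by ring.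
apply: trboundD; last first.
  apply/trboundN/trbound_psd.
    apply: psdmxZ; first by rewrite divr_ge0 ?ler0n.
    by apply: psdmxD; [apply: dD1.1|apply: dD2.1].
  by rewrite mxtraceZ mxtraceD dD1.2 dD2.2 mulfVK ?pnatr_eq0.
apply: trboundD; last first.
  apply: trbound_psd; first by apply: psdmxZ => //; apply: dS.1.
  by rewrite mxtraceZ dS.2 mulr1.
apply: trboundD; last first.
  apply: trbound_psd; first by apply: psdmx_conj; apply: dS.1.
  by rewrite FE -[t ^+ 2]real_normK //; apply: mxtrace_udiag_conj_le.
apply: trbound_cross; first exact: dS.1.
rewrite /X /T !adjmxZ adjmx1 tC -!(scalemxAl, scalemxAr) !scalerA mulmx1 mul1mx.
rewrite !mxtraceZ dS.2 mulr1 -expr2 -[17]/(16 + 1)%:R natrD mulrDl mul1r.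
rewrite lerD // mulrC ler_wpM2r // (_ : 16%:R = 4 ^+ 2); last by ring.
exact: mxtrace_udiag_conj_le.
Qed.

End StepEstimate.

(** * Closure properties of channels and of density operators *)

Section Channels.
Context {C : numClosedFieldType}.

Definition is_channel m k (Phi : 'M[C]_m -> 'M[C]_k) : Prop :=
  exists (r : nat) (K : 'I_r -> 'M[C]_(k, m)),
    \sum_(j < r) (K j) ^t* *m K j = 1%:M /\
    forall X, Phi X = \sum_(j < r) K j *m X *m (K j) ^t*.

(** Allows Kraus families indexed by products, booleans and basis indices; enumerating [I] recovers
    an ordinal index. *)
Lemma channel_fin (I : finType) m k (K : I -> 'M[C]_(k, m)) :
  \sum_j (K j) ^t* *m K j = 1%:M ->
  is_channel (fun X => \sum_j K j *m X *m (K j) ^t*).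
Proof.
move=> K1; exists #|I|, (K \o enum_val); split=> [|X].
  by rewrite -K1 (reindex _ (onW_bij _ (enum_val_bij I))).
by rewrite (reindex _ (onW_bij _ (enum_val_bij I))).
Qed.

Lemma channel_comp m k l (Phi : 'M[C]_m -> 'M[C]_k) (Psi : 'M[C]_k -> 'M[C]_l) :
  is_channel Phi -> is_channel Psi -> is_channel (Psi \o Phi).
Proof.
move=> [r [K [K1 KE]]] [s [J [J1 JE]]].
have [|q [L [L1 LE]]] := @channel_fin ('I_s * 'I_r)%type _ _
    (fun x => J x.1 *m K x.2).
  rewrite -(pair_bigA _ (fun x y => (J x *m K y) ^t* *m (J x *m K y))) /=.
  rewrite exchange_big /= -K1; apply: eq_bigr => y _.
  rewrite (eq_bigr (fun x => (K y) ^t* *m ((J x) ^t* *m J x) *m K y)) => [|x _].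
    by rewrite -mulmx_suml -mulmx_sumr J1 mulmx1.
  by rewrite adjmxM !mulmxA.
exists q, L; split=> // X; rewrite -LE /= JE KE.
rewrite -(pair_bigA _ (fun x y => J x *m K y *m X *m (J x *m K y) ^t*)) /=.
apply: eq_bigr => x _; rewrite mulmx_sumr mulmx_suml; apply: eq_bigr => y _.
by rewrite adjmxM !mulmxA.
Qed.

Lemma channel_density m k (Phi : 'M[C]_m -> 'M[C]_k) X :
  is_channel Phi -> is_density X -> is_density (Phi X).
Proof.
move=> [r [K [K1 KE]]] [pX tX]; split.
  by rewrite KE; apply: psdmx_sum => j; apply: psdmx_conj.
rewrite KE raddf_sum /= (eq_bigr (fun j => \tr ((K j) ^t* *m K j *m X))) => [|j _].
  by rewrite -raddf_sum -mulmx_suml K1 mul1mx.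
by rewrite mxtrace_mulC mulmxA.
Qed.

Lemma channel_tens p m k (Phi : 'M[C]_m -> 'M[C]_k) : is_channel Phi ->
  exists2 Psi : 'M[C]_(p * m) -> 'M[C]_(p * k), is_channel Psi &
    forall A X, Psi (A *t X) = A *t Phi X.
Proof.
move=> [r [K [K1 KE]]].
have tens_sum q q' (A : 'M[C]_p) (F : 'I_r -> 'M[C]_(q, q')) :
    \sum_j A *t F j = A *t (\sum_j F j).
  apply/matrixP => i j; rewrite summxE mxE summxE mulr_sumr.
  by apply: eq_bigr => x _; rewrite mxE.
exists (fun X => \sum_j (1%:M *t K j) *m X *m (1%:M *t K j) ^t*).
  exists r, (fun j => 1%:M *t K j); split=> //.
  rewrite (eq_bigr (fun j => 1%:M *t ((K j) ^t* *m K j))) => [|j _].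
    by rewrite tens_sum K1 tensmx11.
  by rewrite adjmx_tens adjmx1 tensmx_mul mul1mx.
move=> A X; rewrite KE -tens_sum; apply: eq_bigr => j _.
by rewrite adjmx_tens adjmx1 !tensmx_mul mul1mx mulmx1.
Qed.

(** Row [u] is the basis vector at [f u]. If [f] fixes the program registers at x, this is <x| (x)
    1, a Kraus operator of the partial trace. *)
Definition selmx k m (f : 'I_k -> 'I_m) : 'M[C]_(k, m) :=
  \matrix_(u, j) (j == f u)%:R.

Lemma selmx_conj k m (f g : 'I_k -> 'I_m) (X : 'M[C]_m) :
  selmx f *m X *m (selmx g) ^t* = mxsub f g X.
Proof.
apply/matrixP => u v; rewrite mxE [RHS]mxE (bigD1 (g v)) //= big1 => [|j jg].
  rewrite addr0 !mxE eqxx conjC1 mulr1 (bigD1 (f u)) //= big1 => [|j jf].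
    by rewrite addr0 mxE eqxx mul1r.
  by rewrite mxE (negPf jf) mul0r.
by rewrite !mxE (negPf jg) conjC0 mulr0.
Qed.

Lemma selmx_adjM k m (f g : 'I_k -> 'I_m) i j :
  ((selmx f) ^t* *m selmx g) i j = \sum_u ((i == f u) && (j == g u))%:R.
Proof.
rewrite mxE; apply: eq_bigr => u _.
by rewrite !mxE conjC_nat -natrM mulnb.
Qed.

(** Each basis index is hit exactly once by [h], so the coordinate projections add up to the
    identity. *)
Lemma selmx_complete (I : finType) k m (h : I * 'I_k -> 'I_m) : bijective h ->
  \sum_x (selmx (fun u => h (x, u))) ^t* *m selmx (fun u => h (x, u)) = 1%:M.
Proof.
move=> [h' hK hK']; apply/matrixP => i j; rewrite summxE mxE.
rewrite (eq_bigr (fun x => \sum_u ((i == h (x, u)) && (j == h (x, u)))%:R)); last first.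
  by move=> x _; rewrite selmx_adjM.
rewrite pair_bigA /= (eq_bigr (fun p => ((i == h p) && (j == h p))%:R)) => [|[]//].
rewrite (bigD1 (h' i)) //= big1 => [|p pi].
  by rewrite addr0 hK' eqxx eq_sym.
by case: (i =P h p) => //= ip; rewrite ip hK eqxx in pi.
Qed.

Lemma channel_mxsub k m (f : 'I_k -> 'I_m) : bijective f ->
  is_channel (mxsub f f : 'M[C]_m -> 'M[C]_k).
Proof.
move=> [f' fK fK']; have fbij : bijective (fun x : unit * 'I_k => f x.2).
  by exists (fun j => (tt, f' j)) => [[[] u]|j] /=; rewrite ?fK ?fK'.
have [r [K [K1 KE]]] := channel_fin (selmx_complete fbij).
exists r, K; split=> // X.
by rewrite -KE (bigD1 tt) //= big1 ?addr0 ?selmx_conj // => -[].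
Qed.

Lemma psdmx_factor n (A : 'M[C]_n) : is_psd A -> exists B : 'M[C]_n, A = B *m B ^t*.
Proof.
move=> pA; have [V [d [VU dR AE]]] := herm_spectral pA.1.
have d0 k : 0 <= d k by rewrite -(udiag_entry d k VU) -AE pA.2.
exists (udiag V (fun k => sqrtC (d k))).
rewrite udiag_adj udiagM // AE; apply: udiag_ext => k.
by rewrite geC0_conj ?sqrtC_ge0 // -expr2 sqrtCK.
Qed.

Lemma mxtrace_tens m n (A : 'M[C]_m) (B : 'M[C]_n) :
  \tr (A *t B) = \tr A * \tr B.
Proof.
rewrite /mxtrace mulr_sum; apply: eq_bigr => i _.
by rewrite !mxE.
Qed.

Lemma density_tens m n (A : 'M[C]_m) (B : 'M[C]_n) :
  is_density A -> is_density B -> is_density (A *t B).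
Proof.
move=> [pA tA] [pB tB]; split; last by rewrite mxtrace_tens tA tB mulr1.
have [X ->] := psdmx_factor pA; have [Y ->] := psdmx_factor pB.
rewrite -tensmx_mul -adjmx_tens -{1}[X *t Y]mulmx1; apply: psdmx_conj.
exact: psdmx1.
Qed.

End Channels.

(** * The one-step channel built from the cyclic shift *)

Section Step.
Context {C : numClosedFieldType}.

Lemma kraus_adjM (I : finType) m k (A B : I -> 'M[C]_(k, m)) a b :
  \sum_x (a *: A x + b *: B x) ^t* *m (a *: A x + b *: B x) =
  (conjC a * a) *: (\sum_x (A x) ^t* *m A x)
  + (conjC a * b) *: (\sum_x (A x) ^t* *m B x)
  + (conjC b * a) *: (\sum_x (B x) ^t* *m A x)
  + (conjC b * b) *: (\sum_x (B x) ^t* *m B x).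
Proof.
rewrite !scaler_sumr -!big_split; apply: eq_bigr => x _.
rewrite adjmxD !adjmxZ !(mulmxDl, mulmxDr) -!(scalemxAl, scalemxAr) !scalerA /=.
move: ((A x) ^t* *m A x) ((A x) ^t* *m B x) ((B x) ^t* *m A x) ((B x) ^t* *m B x).
by move=> m1 m2 m3 m4; apply/matrixP => i j; rewrite !mxE; ring.
Qed.

Lemma kraus_conj (I : finType) m k (A B : I -> 'M[C]_(k, m)) a b X :
  \sum_x (a *: A x + b *: B x) *m X *m (a *: A x + b *: B x) ^t* =
  (a * conjC a) *: (\sum_x A x *m X *m (A x) ^t*)
  + (a * conjC b) *: (\sum_x A x *m X *m (B x) ^t*)
  + (b * conjC a) *: (\sum_x B x *m X *m (A x) ^t*)
  + (b * conjC b) *: (\sum_x B x *m X *m (B x) ^t*).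
Proof.
rewrite !scaler_sumr -!big_split; apply: eq_bigr => x _.
rewrite adjmxD !adjmxZ !(mulmxDl, mulmxDr) -!(scalemxAl, scalemxAr) !scalerA /=.
move: (A x *m X *m (A x) ^t*) (A x *m X *m (B x) ^t*).
move: (B x *m X *m (A x) ^t*) (B x *m X *m (B x) ^t*).
by move=> m1 m2 m3 m4; apply/matrixP => i j; rewrite !mxE; ring.
Qed.

Variables d e : nat.
Local Notation T := ('I_d * 'I_d * 'I_(d * e))%type.

Lemma tensmx1_mulE (A : 'M[C]_d) (S : 'M[C]_(d * e)) i k v :
  ((A *t 1%:M) *m S) (mxtens_index (i, k)) v
  = \sum_a A i a * S (mxtens_index (a, k)) v.
Proof.
rewrite mxE (reindex (@mxtens_index d e)) /=; last first.
  by apply: onW_bij; exists (@mxtens_unindex d e);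
    [apply: mxtens_indexK|apply: mxtens_unindexK].
rewrite (eq_bigr (fun p => A i p.1 * (k == p.2)%:R
    * S (mxtens_index (p.1, p.2)) v)) => [|[a b] _]; last by rewrite tensmxE mxE.
rewrite -(pair_bigA _ (fun a b => A i a * (k == b)%:R * S (mxtens_index (a, b)) v)).
apply: eq_bigr => a _; rewrite (bigD1 k) //= big1 => [|b bk].
  by rewrite eqxx mulr1 addr0.
by rewrite eq_sym (negPf bk) mulr0 mul0r.
Qed.

(* The three registers carrying rho1, rho2 and the A-part of sigma are permuted
   cyclically by [cyc]; [cyc'] is its inverse. *)
Let glue (x : T) : 'I_(d * d * (d * e)) := mxtens_index (mxtens_index x.1, x.2).
Let cyc (x : T) : T := let w := mxtens_unindex x.2 in
  ((x.1.2, w.1), mxtens_index (x.1.1, w.2)).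
Let cyc' (x : T) : T := let w := mxtens_unindex x.2 in
  ((w.1, x.1.1), mxtens_index (x.1.2, w.2)).

Let cycE a b i k : cyc ((a, b), mxtens_index (i, k)) = ((b, i), mxtens_index (a, k)).
Proof. by rewrite /cyc mxtens_indexK. Qed.

Let cyc'E a b i k : cyc' ((a, b), mxtens_index (i, k)) = ((i, a), mxtens_index (b, k)).
Proof. by rewrite /cyc' mxtens_indexK. Qed.

Let cycK : cancel cyc cyc'.
Proof. by move=> [[a b] u]; case: (mxtens_indexP u) => i k; rewrite cycE cyc'E. Qed.

Let cyc'K : cancel cyc' cyc.
Proof. by move=> [[a b] u]; case: (mxtens_indexP u) => i k; rewrite cyc'E cycE. Qed.

Let glue_bij : bijective glue.
Proof.
exists (fun j => (mxtens_unindex (mxtens_unindex j).1, (mxtens_unindex j).2)).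
  by move=> [x u]; rewrite /glue !mxtens_indexK.
move=> j; case: (mxtens_indexP j) => x u; case: (mxtens_indexP x) => a b.
by rewrite /glue !mxtens_indexK.
Qed.

Let P x : 'M[C]_(d * e, _) := selmx (fun u => glue (x, u)).
Let Q x : 'M[C]_(d * e, _) := selmx (fun u => glue (cyc (x, u))).
Let Q' x : 'M[C]_(d * e, _) := selmx (fun u => glue (cyc' (x, u))).

Let PP : \sum_x (P x) ^t* *m P x = 1%:M.
Proof. exact: selmx_complete. Qed.

Let QQ : \sum_x (Q x) ^t* *m Q x = 1%:M.
Proof.
apply: (selmx_complete (h := glue \o cyc)).
by apply: bij_comp => //; exists cyc'.
Qed.

Let QQ' : \sum_x (Q' x) ^t* *m Q' x = 1%:M.
Proof.
apply: (selmx_complete (h := glue \o cyc')).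
by apply: bij_comp => //; exists cyc.
Qed.

(** Both sides are the permutation matrix of one cyclic shift, as reindexing by [cyc] shows. This
    pairs the cross terms of the two families so that they cancel in the completeness relation. *)
Let PQ : \sum_x (P x) ^t* *m Q x = \sum_x (Q' x) ^t* *m P x.
Proof.
apply/matrixP => i j; rewrite !summxE.
rewrite (eq_bigr _ (fun x _ => selmx_adjM _ _ i j)).
rewrite [RHS](eq_bigr _ (fun x _ => selmx_adjM _ _ i j)).
rewrite !pair_bigA.
transitivity (\sum_p ((i == glue p) && (j == glue (cyc p)))%:R : C).
  by apply: eq_bigr => -[].
transitivity (\sum_p ((i == glue (cyc' p)) && (j == glue p))%:R : C); last first.
  by apply: eq_bigr => -[].
rewrite [RHS](reindex cyc); last by apply: onW_bij; exists cyc'.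
by apply: eq_bigr => p _; rewrite cycK.
Qed.

Let QP : \sum_x (Q x) ^t* *m P x = \sum_x (P x) ^t* *m Q' x.
Proof.
transitivity ((\sum_x (P x) ^t* *m Q x) ^t*).
  by rewrite adjmx_sum; apply: eq_bigr => x _; rewrite adjmxM trmxCK.
by rewrite PQ adjmx_sum; apply: eq_bigr => x _; rewrite adjmxM trmxCK.
Qed.

Implicit Types (r : 'M[C]_d) (S : 'M[C]_(d * e)).

Let XE r1 r2 S a b u a' b' u' :
  (r1 *t r2 *t S) (glue ((a, b), u)) (glue ((a', b'), u')) = r1 a a' * r2 b b' * S u u'.
Proof. by rewrite /glue !tensmxE. Qed.

Let PXP r1 r2 S : \tr r1 = 1 -> \tr r2 = 1 ->
  \sum_x P x *m (r1 *t r2 *t S) *m (P x) ^t* = S.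
Proof.
move=> t1 t2; apply/matrixP => u v; rewrite summxE.
rewrite (eq_bigr (fun p => r1 p.1 p.1 * r2 p.2 p.2 * S u v)) => [|[a b] _]; last first.
  by rewrite selmx_conj mxE XE.
rewrite -mulr_suml -(pair_bigA _ (fun a b => r1 a a * r2 b b)) /=.
rewrite (eq_bigr (fun a => r1 a a)) => [|a _].
  by rewrite -/(\tr r1) t1 mul1r.
by rewrite -mulr_sumr -/(\tr r2) t2 mulr1.
Qed.

(** A three-register swap trick: tracing out the program registers after a one-sided shift chains
    the indices of the program states into a matrix product. The direction of the shift decides the
    order of the factors. *)
Let QXP r1 r2 S :
  \sum_x Q x *m (r1 *t r2 *t S) *m (P x) ^t* = ((r2 *m r1) *t 1%:M) *m S.
Proof.
apply/matrixP => u v; case: (mxtens_indexP u) => i k.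
rewrite summxE tensmx1_mulE.
rewrite (eq_bigr (fun p => r1 p.2 p.1 * r2 i p.2 * S (mxtens_index (p.1, k)) v));
  last by move=> [a b] _; rewrite selmx_conj mxE cycE XE.
rewrite -(pair_bigA _ (fun a b => r1 b a * r2 i b * S (mxtens_index (a, k)) v)) /=.
apply: eq_bigr => a _; rewrite mxE mulr_suml; apply: eq_bigr => b _.
by rewrite [r1 _ _ * _]mulrC.
Qed.

Let Q'XP r1 r2 S :
  \sum_x Q' x *m (r1 *t r2 *t S) *m (P x) ^t* = ((r1 *m r2) *t 1%:M) *m S.
Proof.
apply/matrixP => u v; case: (mxtens_indexP u) => i k.
rewrite summxE tensmx1_mulE.
rewrite (eq_bigr (fun p => r1 i p.1 * r2 p.1 p.2 * S (mxtens_index (p.2, k)) v));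
  last by move=> [a b] _; rewrite selmx_conj mxE cyc'E XE.
rewrite -(pair_bigA _ (fun a b => r1 i a * r2 a b * S (mxtens_index (b, k)) v)) /=.
rewrite exchange_big; apply: eq_bigr => b _.
by rewrite mxE mulr_suml.
Qed.

(* The Kraus operators are <x| (c - i s w^* S) / sqrt 2 and
   <x| (c - i s w S^-1) / sqrt 2, where S is a cyclic shift and <x| runs over the
   basis of the program registers. Neither c - i s w^* S nor its partner is
   unitary, but the defects cancel in the completeness relation. *)
Lemma step_channel (c s w : C) : c \is Num.real -> s \is Num.real ->
  c ^+ 2 + s ^+ 2 = 1 -> w * conjC w = 1 ->
  exists2 L : 'M[C]_(d * d * (d * e)) -> 'M[C]_(d * e), is_channel L &
    forall r1 r2 S, is_density r1 -> is_density r2 -> is_density S ->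
    exists D1 D2, [/\ is_density D1, is_density D2 &
      let H := (2^-1 *: (w *: (r1 *m r2) + conjC w *: (r2 *m r1))) *t 1%:M in
      L (r1 *t r2 *t S) = c ^+ 2 *: S + (s ^+ 2 / 2) *: (D1 + D2)
        - ('i * (c * s)) *: (H *m S - S *m H)].
Proof.
move=> cR sR cs ww.
(* [q] is the square root of 2; dividing every Kraus operator by it gives each of the two
   conjugations weight 1/2. *)
have [q [q2 q0 qC]] : exists q : C, [/\ q ^+ 2 = 2, q != 0 & conjC q = q].
  exists (sqrtC 2); rewrite sqrtCK sqrtC_eq0 pnatr_eq0; split=> //.
  by rewrite geC0_conj // sqrtC_ge0 ler0n.
pose a := c / q.
pose b := - 'i * s * conjC w / q; pose b' := - 'i * s * w / q.
have aC : conjC a = c / q by rewrite /a fmorph_div /= qC conj_Creal.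
have bC : conjC b = 'i * s * w / q.
  by rewrite /b fmorph_div /= qC !rmorphM rmorphN /= conjCi opprK conjCK conj_Creal.
have b'C : conjC b' = 'i * s * conjC w / q.
  by rewrite /b' fmorph_div /= qC !rmorphM rmorphN /= conjCi opprK conj_Creal.
pose K (y : 'I_d * 'I_d * bool) :=
  if y.2 then a *: P y.1 + b *: Q y.1 else a *: P y.1 + b' *: Q' y.1.
have aa : conjC a * a = c ^+ 2 / 2.
  by rewrite aC /a -q2; field.
have bb : conjC b * b = s ^+ 2 / 2.
  rewrite bC /b -q2 [LHS](_ : _ = - 'i ^+ 2 * s ^+ 2 * (w * conjC w) / q ^+ 2);
    last by field.
  by rewrite sqrCi opprK mul1r ww mulr1.
have bb' : conjC b' * b' = s ^+ 2 / 2.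
  rewrite b'C /b' -q2 [LHS](_ : _ = - 'i ^+ 2 * s ^+ 2 * (w * conjC w) / q ^+ 2);
    last by field.
  by rewrite sqrCi opprK mul1r ww mulr1.
have ab : conjC a * b = - 'i * (c * s) * conjC w / 2.
  by rewrite aC /b -q2; field.
have ba : conjC b * a = 'i * (c * s) * w / 2.
  by rewrite bC /a -q2; field.
have ab' : conjC a * b' = - 'i * (c * s) * w / 2.
  by rewrite aC /b' -q2; field.
have ba' : conjC b' * a = 'i * (c * s) * conjC w / 2.
  by rewrite b'C /a -q2; field.
have sumK m n (F : 'M[C]_(d * e, d * d * (d * e)) -> 'M[C]_(m, n)) : \sum_y F (K y) =
    \sum_x F (a *: P x + b *: Q x) + \sum_x F (a *: P x + b' *: Q' x).
  rewrite -(pair_bigA _ (fun x y => F (K (x, y)))) -big_split /=.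
  by apply: eq_bigr => x _; rewrite big_bool.
have K1 : \sum_y (K y) ^t* *m K y = 1%:M.
  rewrite (sumK _ _ (fun A => A ^t* *m A)) !kraus_adjM PP QQ QQ' PQ QP.
  rewrite aa bb bb' ab ba ab' ba'.
  move: (\sum_x (Q' x) ^t* *m P x) (\sum_x (P x) ^t* *m Q' x) => Z1 Z2.
  have s2 : s ^+ 2 = 1 - c ^+ 2 by rewrite -cs addrAC subrr add0r.
  by apply/matrixP => i j; rewrite !mxE s2; field.
exists (fun X => \sum_y K y *m X *m (K y) ^t*); first exact: channel_fin.
move=> r1 r2 S d1 d2 dS; pose X := r1 *t r2 *t S.
have dX : is_density X by apply: density_tens => //; apply: density_tens.
(* The terms in s^2 are outputs of the pure shifts followed by the partial trace, which are
   channels, hence states. *)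
exists (\sum_x Q x *m X *m (Q x) ^t*), (\sum_x Q' x *m X *m (Q' x) ^t*); split.
- exact: (channel_density (channel_fin QQ)).
- exact: (channel_density (channel_fin QQ')).
have PXQ : \sum_x P x *m X *m (Q x) ^t* = S *m ((r1 *m r2) *t 1%:M).
  transitivity ((\sum_x Q x *m X *m (P x) ^t*) ^t*).
    rewrite adjmx_sum; apply: eq_bigr => x _.
    by rewrite !adjmxM trmxCK dX.1.1 mulmxA.
  by rewrite QXP !(adjmxM, adjmx_tens) adjmx1 d1.1.1 d2.1.1 dS.1.1.
have PXQ' : \sum_x P x *m X *m (Q' x) ^t* = S *m ((r2 *m r1) *t 1%:M).
  transitivity ((\sum_x Q' x *m X *m (P x) ^t*) ^t*).
    rewrite adjmx_sum; apply: eq_bigr => x _.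
    by rewrite !adjmxM trmxCK dX.1.1 mulmxA.
  by rewrite Q'XP !(adjmxM, adjmx_tens) adjmx1 d1.1.1 d2.1.1 dS.1.1.
rewrite /= (sumK _ _ (fun A => A *m X *m A ^t*)) !kraus_conj.
rewrite PXP ?d1.2 ?d2.2 // PXQ PXQ' QXP Q'XP.
rewrite ![_ * conjC _]mulrC aa bb bb' ab ba ab' ba'.
have tE (A B : 'M[C]_d) : (2^-1 *: (w *: A + conjC w *: B)) *t (1%:M : 'M[C]_e)
    = (w / 2) *: (A *t 1%:M) + (conjC w / 2) *: (B *t 1%:M).
  by apply/matrixP => i j; rewrite !mxE; field.
rewrite tE mulmxDl mulmxDr -!(scalemxAl, scalemxAr).
move: (((r1 *m r2) *t 1%:M) *m S) (((r2 *m r1) *t 1%:M) *m S) => m1 m2.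
move: (S *m ((r1 *m r2) *t 1%:M)) (S *m ((r2 *m r1) *t 1%:M)) => m3 m4.
move: (\sum_x Q x *m X *m (Q x) ^t*) (\sum_x Q' x *m X *m (Q' x) ^t*) => m5 m6.
by apply/matrixP => i j; rewrite !mxE; field.
Qed.

End Step.

(** * Composing n steps, each consuming one fresh copy of both programs *)

Section Iteration.
Context {C : numClosedFieldType}.

(** The recursion of [tpow] over a general closed field; [tpowE] identifies the two. *)
Fixpoint tenspow d (A : 'M[C]_d) (n : nat) : 'M[C]_(d ^ n) :=
  match n with
  | 0 => castmx (esym (expn0 d), esym (expn0 d)) (1%:M : 'M[C]_1)
  | n'.+1 => castmx (esym (expnS d n'), esym (expnS d n')) (A *t tenspow A n')
  end.

Let pair_pow d n (a : 'I_d) (x : 'I_(d ^ n)) : 'I_(d ^ n.+1) :=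
  cast_ord (esym (expnS d n)) (mxtens_index (a, x)).

Let tenspowSE d (A : 'M[C]_d) n a x b y :
  tenspow A n.+1 (pair_pow a x) (pair_pow b y) = A a b * tenspow A n x y.
Proof. by rewrite /= castmxE /pair_pow /= !cast_ord_comp !cast_ord_id tensmxE. Qed.

Lemma mxtens_index_inj m n (a c : 'I_m) (b d : 'I_n) :
  mxtens_index (a, b) = mxtens_index (c, d) -> a = c /\ b = d.
Proof. by move/(can_inj (@mxtens_indexK m n)) => E; case: E. Qed.

(** Induction on [n]: a permutation of the registers moves the first copy of each program next to
    the system, [L] acts there, and the remaining copies go to the channel for [n] steps. *)
Lemma iter_channel d N (L : 'M[C]_(d * d * N) -> 'M[C]_N) n : is_channel L ->
  exists2 Phi : 'M[C]_(d ^ n * d ^ n * N) -> 'M[C]_N, is_channel Phi &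
    forall r1 r2 S, Phi (tenspow r1 n *t tenspow r2 n *t S)
      = iter n (fun Z => L (r1 *t r2 *t Z)) S.
Proof.
move=> cL; elim: n => [|n [Phi cPhi PhiE]].
  (* With no copies the program registers are one-dimensional, so the channel only drops their
     trivial indices. *)
  pose f (u : 'I_N) : 'I_(d ^ 0 * d ^ 0 * N) :=
    mxtens_index (mxtens_index (ord0, ord0), u).
  exists (mxsub f f).
    apply/channel_mxsub/inj_card_bij; last by rewrite !card_ord !mul1n.
    by move=> u v /mxtens_index_inj[].
  move=> r1 r2 S; apply/matrixP => u v; rewrite mxE !tensmxE /=.
  by rewrite !castmxE /= !mxE !mul1r.
have [Psi cPsi PsiE] := channel_tens (d ^ n * d ^ n) cL.
pose f (j : 'I_(d ^ n * d ^ n * (d * d * N))) : 'I_(d ^ n.+1 * d ^ n.+1 * N) :=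
  let p := mxtens_unindex (mxtens_unindex j).1 in
  let q := mxtens_unindex (mxtens_unindex j).2 in
  let ab := mxtens_unindex q.1 in
  mxtens_index (mxtens_index (pair_pow ab.1 p.1, pair_pow ab.2 p.2), q.2).
have fE x y a b u : f (mxtens_index (mxtens_index (x, y),
      mxtens_index (mxtens_index (a, b), u)))
    = mxtens_index (mxtens_index (pair_pow a x, pair_pow b y), u).
  by rewrite /f !mxtens_indexK.
have split5 j : exists x y a b u, j = mxtens_index (mxtens_index (x, y),
      mxtens_index (mxtens_index (a, b), u)) :> 'I_(d ^ n * d ^ n * (d * d * N)).
  case: (mxtens_indexP j) => p q; case: (mxtens_indexP p) => x y.
  by case: (mxtens_indexP q) => ab u; case: (mxtens_indexP ab) => a b;
    exists x, y, a, b, u.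
have fbij : bijective f.
  apply: inj_card_bij; last by rewrite !card_ord !expnS; lia.
  move=> j j'; have [x [y [a [b [u ->]]]]] := split5 j.
  have [x' [y' [a' [b' [u' ->]]]]] := split5 j'.
  rewrite !fE => /mxtens_index_inj[/mxtens_index_inj[+ +] ->].
  by move=> /cast_ord_inj/mxtens_index_inj[-> ->]
    /cast_ord_inj/mxtens_index_inj[-> ->].
exists (Phi \o (Psi \o mxsub f f)).
  by apply: channel_comp => //; apply: channel_comp => //; apply: channel_mxsub.
(* The peeled copies feed the innermost application of [L], which is why the iterate is unfolded on
   the right. What remains is a comparison of entries before and after the permutation. *)
move=> r1 r2 S; rewrite iterSr -PhiE /= -PsiE; congr (Phi (Psi _)).
apply/matrixP => j j'; rewrite mxE; have [x [y [a [b [u ->]]]]] := split5 j.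
have [x' [y' [a' [b' [u' ->]]]]] := split5 j'.
by rewrite !fE !tensmxE !tenspowSE; ring.
Qed.

End Iteration.

(** * Accumulated error and the norm of the Hamiltonian *)

Section Simulation.
Context {C : numClosedFieldType}.

(** Hybrid argument: inserting the exact step applied to the simulated state splits off one new
    error [eps], and unitary conjugation does not enlarge the error already made. *)
Lemma telescope n (U S : 'M[C]_n) (f : 'M[C]_n -> 'M[C]_n) eps m :
  U ^t* *m U = 1%:M ->
  (forall Z, is_density Z -> is_density (f Z)) ->
  (forall Z, is_density Z -> trbound (U *m Z *m U ^t* - f Z) eps) ->
  is_density S ->
  trbound (iter m (fun Z => U *m Z *m U ^t*) S - iter m f S) (m%:R * eps).
Proof.
move=> UU fd feps dS; have dm k : is_density (iter k f S) by elim: k => //= k /fd.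
elim: m => [|m IH].
  rewrite subrr mul0r; apply: trbound_psd; first exact: psdmx0.
  by rewrite mxtrace0.
rewrite !iterS -(subrKA (U *m iter m f S *m U ^t*)) -mulmxBl -mulmxBr.
rewrite -natr1 mulrDl mul1r; apply: trboundD; first exact: trbound_unitary.
exact: feps.
Qed.

Lemma udiag_iter n (V S : 'M[C]_n) z m : V \is unitarymx ->
  iter m (fun Z => udiag V z *m Z *m (udiag V z) ^t*) S
  = udiag V (fun k => z k ^+ m) *m S *m (udiag V (fun k => z k ^+ m)) ^t*.
Proof.
move=> VU; elim: m => [|m IH].
  by rewrite udiag1 // adjmx1 mulmx1 mul1mx.
have -> : udiag V (fun k => z k ^+ m.+1) = udiag V z *m udiag V (fun k => z k ^+ m).
  by rewrite udiagM //; apply: udiag_ext => k; rewrite exprS.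
rewrite iterS IH; move: (udiag V z) (udiag V (fun k => z k ^+ m)) => A B.
by rewrite adjmxM !mulmxA.
Qed.

(** Tensoring with the identity repeats every eigenvalue along the second factor, so bounds on
    eigenvalues carry over with no dependence on [e]. *)
Lemma udiag_tens1 d e (V : 'M[C]_d) z :
  udiag V z *t (1%:M : 'M[C]_e)
  = udiag (V *t 1%:M) (fun k => z (mxtens_unindex k).1).
Proof.
rewrite /udiag adjmx_tens adjmx1.
have -> : diag_mx (\row_k z (mxtens_unindex k).1)
    = diag_mx (\row_k z k) *t (1%:M : 'M[C]_e).
  apply/matrixP => i j; case: (mxtens_indexP i) => a k.
  case: (mxtens_indexP j) => a' k'; rewrite tensmxE !mxE mxtens_indexK.
  rewrite (can_eq (@mxtens_indexK _ _)) xpair_eqE.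
  by case: (a == a'); case: (k == k'); rewrite ?mulr1n ?mulr0n ?mulr1 ?mulr0 ?mul0r.
by rewrite !tensmx_mul !mul1mx.
Qed.

Lemma unitarymx_tens1 d e (V : 'M[C]_d) : V \is unitarymx ->
  V *t (1%:M : 'M[C]_e) \is unitarymx.
Proof.
move=> /unitarymxP VV; apply/unitarymxP.
by rewrite adjmx_tens adjmx1 tensmx_mul VV mul1mx tensmx11.
Qed.

(** The eigenvalues of [r] are nonnegative with sum 1, hence at most 1. The squared norm of v r is
    the trace of r S r for the pure state S = v^* v, so [mxtrace_udiag_conj_le] applies. *)
Lemma density_row_le n (r : 'M[C]_n) (v : 'rV[C]_n) :
  is_density r -> (v *m v ^t*) 0 0 = 1 -> ((v *m r) *m (v *m r) ^t*) 0 0 <= 1.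
Proof.
move=> [pr tr] v1; have [W [p [WU pR rE]]] := herm_spectral pr.1.
have p0 k : 0 <= p k by rewrite -(udiag_entry p k WU) -rE pr.2.
have p1 k : `|p k| <= 1.
  rewrite ger0_norm // -tr rE -[udiag _ _]mulmx1 mxtrace_udiag_mul.
  under eq_bigr do rewrite mulmx1 (unitarymxP WU) mxE eqxx mulr1.
  by rewrite (bigD1 k) //= lerDl sumr_ge0.
have dv : is_density (v ^t* *m v).
  split; last by rewrite mxtrace_mulC trace_mx11.
  rewrite -[X in _ *m X]trmxCK -[v ^t* in X in X *m _]mulmx1; apply: psdmx_conj.
  exact: psdmx1.
have := mxtrace_udiag_conj_le WU dv p1; rewrite -rE pr.1 expr1n.
by rewrite adjmxM pr.1 -trace_mx11 -!mulmxA mxtrace_mulC -!mulmxA mxtrace_mulC -!mulmxA.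
Qed.

(** On a unit eigenvector v, with x = v r1 and y = v r2, the number 2 dd k is the cross term in the
    squared norm of w x + y. Positivity for w x + y and w x - y bounds it on both sides by |x|^2 +
    |y|^2, which is at most 2. *)
Lemma hamiltonian_eigenvalue_le n (r1 r2 V : 'M[C]_n) dd w k :
  is_density r1 -> is_density r2 -> V \is unitarymx -> w * conjC w = 1 ->
  dd k \is Num.real ->
  2^-1 *: (w *: (r1 *m r2) + conjC w *: (r2 *m r1)) = udiag V dd ->
  `|dd k| <= 1.
Proof.
move=> d1 d2 VU ww dR HE; pose v := row k V.
have v1 : (v *m v ^t*) 0 0 = 1.
  by rewrite -{1}[v]mulmx1 row_conj_entry mulmx1 (unitarymxP VU) mxE eqxx.
pose x := v *m r1; pose y := v *m r2.
have ddE : 2 * dd k = w * (x *m y ^t*) 0 0 + conjC w * (y *m x ^t*) 0 0.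
  rewrite -(udiag_entry dd k VU) -HE /x /y !adjmxM d1.1.1 d2.1.1.
  rewrite -scalemxAr -scalemxAl [X in _ * X]mxE mulrA divff ?pnatr_eq0 // mul1r.
  rewrite mulmxDr mulmxDl -!scalemxAr -!scalemxAl [LHS]mxE.
  by rewrite [X in X + _]mxE [X in _ + X]mxE !mulmxA.
have xx := density_row_le d1 v1; have yy := density_row_le d2 v1.
rewrite -/x -/y in xx yy.
have sq (s : C) : s * s = 1 -> s \is Num.real -> - (s * (2 * dd k)) <= 2.
  move=> ss sR; apply: (@le_trans _ _ ((x *m x ^t*) 0 0 + (y *m y ^t*) 0 0)); last first.
    by rewrite -[2]/(1 + 1)%:R natrD lerD.
  rewrite -subr_ge0 opprK ddE.
  have : 0 <= ((w *: x + s *: y) *m (w *: x + s *: y) ^t*) 0 0.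
    by rewrite mxE sumr_ge0 // => j _; rewrite !mxE mul_conjC_ge0.
  rewrite adjmxD !adjmxZ (conj_Creal sR) mulmxDl !mulmxDr.
  rewrite -!scalemxAl -!scalemxAr !scalerA.
  rewrite ww ss !scale1r; congr (0 <= _).
  by rewrite !mxE [s * conjC w]mulrC [w * s]mulrC; ring.
have := sq 1 (mulr1 1) (real1 _); have := sq (-1) _ _.
rewrite mulrNN mulr1 realN real1 => /(_ erefl isT).
rewrite mulN1r opprK mul1r => h1 h2.
rewrite real_ler_norml //; apply/andP; split.
  by rewrite lerNl -(ler_pM2l (ltr0n C 2)) mulr1 mulrN.
by rewrite -(ler_pM2l (ltr0n C 2)) mulr1.
Qed.

(** The channel is chosen before the states and all spectral data, so the protocol depends only on
    the angles, the phase, the dimensions and [n]. *)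
Lemma protocol_error d e n (a b t w : C) :
  a \is Num.real -> b \is Num.real -> t \is Num.real ->
  a ^+ 2 + b ^+ 2 = 1 -> b ^+ 2 <= t ^+ 2 -> w * conjC w = 1 ->
  exists2 Phi : 'M[C]_(d ^ n * d ^ n * (d * e)) -> 'M[C]_(d * e), is_channel Phi &
    forall (r1 r2 V : 'M[C]_d) (S : 'M[C]_(d * e)) dd z g,
    is_density r1 -> is_density r2 -> is_density S ->
    V \is unitarymx -> (forall k, dd k \is Num.real) ->
    2^-1 *: (w *: (r1 *m r2) + conjC w *: (r2 *m r1)) = udiag V dd ->
    (forall k, conjC (z k) * z k = 1) ->
    (forall k, `|z k - 1| <= `|t|) -> (forall k, `|g k| <= 4) ->
    (forall k, z k - 1 + 'i * (a * b) * dd k = t ^+ 2 * g k) ->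
    let U := udiag V (fun k => z k ^+ n) *t 1%:M in
    trbound (U *m S *m U ^t* - Phi (tenspow r1 n *t tenspow r2 n *t S))
      (n%:R * (20 * t ^+ 2)).
Proof.
move=> aR bR tR ab bt ww.
have [L cL LE] := step_channel d e aR bR ab ww.
have [Phi cPhi PhiE] := iter_channel n cL.
exists Phi => // r1 r2 V S dd z g d1 d2 dS VU ddR HE zz z1 g4 zg U.
have WU := unitarymx_tens1 e VU.
rewrite PhiE /U udiag_tens1 -(udiag_iter _ (fun k => z (mxtens_unindex k).1)) //.
apply: telescope => // [|Z dZ|Z dZ].
- rewrite udiag_adj udiagM // -(udiag1 WU); exact: udiag_ext.
- by apply: (channel_density cL); apply: density_tens => //; apply: density_tens.
have [D1 [D2 [dD1 dD2 ->]]] := LE r1 r2 Z d1 d2 dZ.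
rewrite HE udiag_tens1.
by apply: (step_estimate (g := fun k => g (mxtens_unindex k).1)).
Qed.

Lemma hamiltonian_phase n (A B : 'M[C]_n) (x y i : C) :
  (x / 2) *: (A + B) + (y / 2 * i) *: (A - B)
  = 2^-1 *: ((x + i * y) *: A + (x - i * y) *: B).
Proof. by apply/matrixP => j k; rewrite !mxE; field. Qed.

Lemma hamiltonian_herm n (r1 r2 : 'M[C]_n) w : r1 ^t* = r1 -> r2 ^t* = r2 ->
  let H := 2^-1 *: (w *: (r1 *m r2) + conjC w *: (r2 *m r1)) in H ^t* = H.
Proof.
move=> h1 h2 H; rewrite /H adjmxZ adjmxD !adjmxZ !adjmxM h1 h2 conjCK addrC.
by rewrite fmorphV rmorph_nat.
Qed.

End Simulation.

(** * Specialization to R[i]: trace norm, exponentials and Taylor bounds *)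

Section Complex.
Context {R : realType}.
Local Notation C := R[i].

(** [psd_sqrt] is a choice: the certificate supplies a positive root of small trace, and uniqueness
    of positive roots identifies the chosen one with it. *)
Lemma trnorm_le n (A : 'M[C]_n) (r : R) : trbound A r%:C -> trnorm A <= r.
Proof.
move=> /trbound_sqrt[S [pS SE Sr]]; rewrite /trnorm.
have [] : [set P | psdmx P /\ P *m P = A *m A ^t*]%classic (psd_sqrt (A *m A ^t*)).
  by apply: xgetPex; exists S.
move=> pq qq; have -> : psd_sqrt (A *m A ^t*) = S.
  by apply: psdmx_sqr_inj => //; rewrite qq SE.
by move: Sr; case: (\tr S) => x y; rewrite lecE => /andP[].
Qed.

Lemma normC_real (x : R) : `|x%:C| = `|x|%:C.
Proof. by rewrite normc_def /= expr0n addr0 sqrtr_sqr. Qed.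

Definition expd n (d : 'rV[R]_n) (t : R) (k : 'I_n) : C :=
  cos (- (d 0 k * t)) +i* sin (- (d 0 k * t)).

Lemma expd_exp n (d : 'rV[R]_n) t k m : expd d t k ^+ m = expd d (m%:R * t) k.
Proof.
elim: m => [|m IH]; first by rewrite /expd mul0r mulr0 oppr0 cos0 sin0.
rewrite exprS IH /expd -natr1 mulrDl mul1r mulrDr opprD cosD sinD.
by simpc; congr (_ +i* _); ring.
Qed.

Lemma conjC_phase (x : R) : conjC (cos x +i* sin x) = cos x -i* sin x.
Proof. by []. Qed.

Lemma phase_norm (x : R) : (cos x +i* sin x) * conjC (cos x +i* sin x) = 1.
Proof.
rewrite conjC_phase; simpc; apply/eqP; rewrite eq_complex /= -(cos2Dsin2 x).
by apply/andP; split; apply/eqP; ring.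
Qed.

Lemma normC_le (x y c : R) : `|x| + `|y| <= c -> `|x +i* y| <= c%:C.
Proof.
move=> xyc; rewrite normc_def lecR /=.
have c0 : 0 <= c by apply: le_trans xyc; rewrite addr_ge0.
rewrite -(ger0_norm c0) -sqrtr_sqr ler_wsqrtr //.
rewrite -(real_normK (num_real x)) -(real_normK (num_real y)).
have := normr_ge0 x; have := normr_ge0 y; nra.
Qed.

(** With x = d_k t, the squared modulus of exp(-ix) - 1 is 2 (1 - cos x). *)
Lemma expd_sub1_le n (d : 'rV[R]_n) t k :
  `|d 0 k| <= 1 -> `|expd d t k - 1| <= `|t|%:C.
Proof.
move=> dk; have dt : `|d 0 k * t| <= `|t| by rewrite normrM ler_piMl.
rewrite /expd cosN sinN normc_def lecR /=; set x := d 0 k * t in dt *.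
rewrite -sqrtr_sqr ler_wsqrtr //.
have h1 := one_sub_cos_le x; have h2 := cos2Dsin2 x.
have h3 : x ^+ 2 <= t ^+ 2.
  by rewrite -(real_normK (num_real x)) -(real_normK (num_real t)) ler_pXn2r ?nnegrE.
apply: le_trans h3; apply: le_trans h1.
rewrite oppr0 addr0 sqrrN sqrrB1.
rewrite [leLHS](_ : _ = cos x ^+ 2 + sin x ^+ 2 - cos x *+ 2 + 1); last by ring.
by rewrite h2 [leLHS](_ : _ = 2 * (1 - cos x)) //; ring.
Qed.

(** The constant is 1 + 2 + 1: the real part cos x - 1 gives t^2, and the imaginary part gives 2 t^2
    from cos t sin t - t, by the bound on sine at 2t, and t^2 from sin x - x. *)
Lemma expd_taylor n (d : 'rV[R]_n) t k : `|d 0 k| <= 1 ->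
  `|expd d t k - 1 + 'i * ((cos t)%:C * (sin t)%:C) * (d 0 k)%:C|
    <= (4 * t ^+ 2)%:C.
Proof.
move=> dk; set x := d 0 k * t.
have xt : x ^+ 2 <= t ^+ 2.
  rewrite exprMn ler_piMl ?sqr_ge0 //.
  by rewrite -real_normK ?num_real // exprn_ile1.
have -> : expd d t k - 1 + 'i * ((cos t)%:C * (sin t)%:C) * (d 0 k)%:C
        = (cos x - 1) +i* (cos t * sin t * d 0 k - sin x).
  by rewrite /expd cosN sinN; simpc; congr (_ +i* _); ring.
apply: normC_le.
have -> : cos t * sin t * d 0 k - sin x =
  d 0 k * (cos t * sin t - t) - (sin x - x) by rewrite /x; ring.
have h1 := cos_sub1_le x; have h2 := sin_sub_le x.
have h3 : `|d 0 k * (cos t * sin t - t)| <= 2 * t ^+ 2.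
  rewrite normrM (le_trans (_ : _ <= `|cos t * sin t - t|)) ?ler_piMl //.
  have := sin_sub_le (t *+ 2).
  rewrite (_ : _ - _ = 2 * (cos t * sin t - t)); last by rewrite sin_mulr2n; ring.
  rewrite (_ : (t *+ 2) ^+ 2 = 2 * (2 * t ^+ 2)); last by ring.
  by rewrite normrM ger0_norm ?ler0n // ler_pM2l.
have := ler_normB (d 0 k * (cos t * sin t - t)) (sin x - x); lra.
Qed.

Lemma expd_remainder n (d : 'rV[R]_n) t : (forall k, `|d 0 k| <= 1) ->
  exists2 g : 'I_n -> C, forall k, `|g k| <= 4 &
    forall k, expd d t k - 1 + 'i * ((cos t)%:C * (sin t)%:C) * (d 0 k)%:C
      = t%:C ^+ 2 * g k.
Proof.
move=> d1; pose r k := expd d t k - 1 + 'i * ((cos t)%:C * (sin t)%:C) * (d 0 k)%:C.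
have r4 k : `|r k| <= 4 * t%:C ^+ 2.
  have -> : 4 * t%:C ^+ 2 = (4 * t ^+ 2)%:C by rewrite rmorphM rmorphXn rmorph_nat.
  exact: expd_taylor.
have [t0|t0] := eqVneq (t%:C ^+ 2) 0.
  (* For t = 0 no division is possible, but the bound forces the remainder to vanish. *)
  exists (fun=> 0) => k; first by rewrite normr0 ler0n.
  apply/eqP; rewrite mulr0 -normr_le0 -/(r k).
  by have := r4 k; rewrite t0 mulr0.
exists (fun k => r k / t%:C ^+ 2) => k; last by rewrite [RHS]mulrC divfK.
have t2 : `|t%:C ^+ 2| = t%:C ^+ 2.
  by rewrite ger0_norm // -rmorphXn lecR sqr_ge0.
by rewrite normrM normfV t2 ler_pdivrMr // lt_def t0 -t2 normr_ge0.
Qed.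

(** The spectral theorem shows that the set behind [xget] is inhabited; the basis and eigenvalues
    returned are those attached to the chosen element. *)
Lemma expmiHtP n (H : 'M[C]_n) t : H ^t* = H ->
  exists (V : 'M[C]_n) (d : 'rV[R]_n), [/\ V \is unitarymx,
    H = udiag V (fun k => (d 0 k)%:C) & expmiHt H t = udiag V (expd d t)].
Proof.
move=> hH; have [V [d [VU dR HE]]] := herm_spectral hH.
pose e : 'rV[R]_n := \row_k complex.Re (d k).
have HE' : H = udiag V (fun k => (e 0 k)%:C).
  by rewrite HE; apply: udiag_ext => k; rewrite mxE; move/RRe_real: (dR k) => ->.
rewrite /expmiHt; set P := (X in xget _ X).
have PE : P (udiag V (expd e t)).
  by exists V; exists e; apply: And3; [exact: VU|exact: HE'|reflexivity].
have [W [f [WU HW UW]]] := xgetPex 0 (ex_intro _ _ PE).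
by exists W, f; apply: And3; [exact: WU|exact: HW|exact: UW].
Qed.

Lemma tpowE d (A : 'M[C]_d) n : tpow A n = tenspow A n.
Proof. by elim: n => //= n ->. Qed.

Lemma HphiE d phi (r1 r2 : 'M[C]_d) (w := cos phi +i* sin phi) :
  Hphi phi r1 r2 = 2^-1 *: (w *: (r1 *m r2) + conjC w *: (r2 *m r1)).
Proof.
have h2 x : (x / 2)%:C = x%:C / 2 :> C by rewrite fmorph_div rmorph_nat.
have wE : w = (cos phi)%:C + 'i * (sin phi)%:C by rewrite /w; simpc.
have wE' : conjC w = (cos phi)%:C - 'i * (sin phi)%:C.
  by rewrite /w conjC_phase; simpc.
rewrite wE' wE /Hphi !h2.
exact: hamiltonian_phase.
Qed.

End Complex.

(** * Choice of the number of steps and assembly of the bound *)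

Theorem mainTheorem10 (R : realType) :
  exists (c K : R), 0 < c /\ 0 < K /\
  forall (dA dB : nat) (phi t delta : R),
    0 <= phi < 2 * pi -> 0 < delta ->
    exists n : nat, n%:R <= c * t ^+ 2 / delta + 1 /\
    exists Phi : 'M[R[i]]_(dA ^ n * dA ^ n * (dA * dB)) -> 'M[R[i]]_(dA * dB),
      channel Phi /\
      forall (rho1 rho2 : 'M[R[i]]_dA) (sigma : 'M[R[i]]_(dA * dB)),
        density rho1 -> density rho2 -> density sigma ->
        let U := expmiHt (Hphi phi rho1 rho2) t *t (1%:M : 'M[R[i]]_dB) in
        1 / 2 * trnorm (U *m sigma *m U ^t*
                        - Phi (tpow rho1 n *t tpow rho2 n *t sigma))
        <= K * delta.
Proof.
(* 10 is half of the 20 in the single-step error, because of the factor 1/2 before the trace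
   norm. *)
exists 1, 10; split; first exact: ltr01; split; first exact: ltr0n.
move=> dA dB phi t delta _ delta0.
(* The successor keeps [n] positive even for t = 0, so that t / n makes sense, and places t^2 /
   delta strictly below [n]. *)
pose n := (truncn (t ^+ 2 / delta)).+1; exists n.
have q0 : 0 <= t ^+ 2 / delta by rewrite divr_ge0 ?sqr_ge0 // ltW.
have /andP[qn nq] := truncn_itv q0.
split; first by rewrite /n -natr1 mul1r lerD2r.
have n0 : 0 < n%:R :> R by rewrite ltr0n.
pose tau := t / n%:R; have ntau : n%:R * tau = t by rewrite mulrC divfK ?gt_eqF.
have realC (x : R) : x%:C \is Num.real by rewrite complex_real.
have cs1 : (cos tau)%:C ^+ 2 + (sin tau)%:C ^+ 2 = 1 :> R[i].
  by rewrite -!rmorphXn -rmorphD /= cos2Dsin2.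
have st : (sin tau)%:C ^+ 2 <= tau%:C ^+ 2.
  rewrite -!rmorphXn /= lecR -(real_normK (num_real (sin tau))).
  by rewrite -(real_normK (num_real tau)) ler_pXn2r ?nnegrE // sin_norm_le.
have [Phi cPhi PhiE] := protocol_error dA dB n (realC (cos tau)) (realC (sin tau))
  (realC tau) cs1 st (phase_norm phi).
exists Phi; split; first exact: cPhi.
move=> rho1 rho2 sigma d1 d2 ds; cbv zeta.
set U := expmiHt _ _ *t _.
have HE := HphiE phi rho1 rho2.
have hH : (Hphi phi rho1 rho2) ^t* = Hphi phi rho1 rho2.
  by rewrite HE; apply: hamiltonian_herm; [exact: d1.1.1|exact: d2.1.1].
have [V [d [VU HV UV]]] := expmiHtP t hH.
have dle k : `|d 0 k| <= 1.
  have := hamiltonian_eigenvalue_le (dd := fun k => (d 0 k)%:C)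
    d1 d2 VU (phase_norm phi) (realC (d 0 k)) (etrans (esym HE) HV).
  by rewrite normC_real lecR.
have [g g4 gE] := expd_remainder tau dle.
have zz k : conjC (expd d tau k) * expd d tau k = 1.
  by rewrite mulrC phase_norm.
have z1 k : `|expd d tau k - 1| <= `|tau%:C|.
  by rewrite normC_real; apply: expd_sub1_le.
have key := PhiE rho1 rho2 V sigma _ _ _ d1 d2 ds VU (fun k => realC (d 0 k))
  (etrans (esym HE) HV) zz z1 g4 gE.
have UE : expmiHt (Hphi phi rho1 rho2) t = udiag V (fun k => expd d tau k ^+ n).
  by rewrite UV; apply: udiag_ext => k; rewrite expd_exp ntau.
rewrite /U UE (tpowE rho1) (tpowE rho2).
have eE : n%:R * (20 * tau%:C ^+ 2) = (n%:R * (20 * tau ^+ 2))%:C :> R[i].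
  by rewrite [RHS]rmorphM [X in _ = _ * X]rmorphM rmorphXn !rmorph_nat.
rewrite eE in key; have := trnorm_le key; set x := trnorm _ => xle.
(* The total error is 20 n tau^2 = 20 t^2 / n, and n exceeds t^2 / delta. *)
have nt : n%:R * tau ^+ 2 <= delta.
  have -> : n%:R * tau ^+ 2 = t ^+ 2 / n%:R by rewrite /tau; field; rewrite gt_eqF.
  by rewrite ler_pdivrMr // mulrC -ler_pdivrMr // ltW.
by move: xle; rewrite mulrCA; lra.
Qed.
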